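(* Let $G$ be a $4$-regular graph with $\chi'(G)=4$. Then every proper $5$-edge coloring of $G$ can be transformed to any proper $4$-edge coloring of $G$ by a sequence of interchanges.
   Context: All graphs are finite, without loops and multiple edges. A proper $t$-edge coloring of $G$ is a map $f:E(G)\to\{1,\dots,t\}$ with $f(e)\neq f(e')$ for adjacent edges $e,e'$; $\chi'(G)$ is the least $t$ admitting one. A proper $4$-edge coloring is regarded as a proper $5$-edge coloring not using color $5$. For a proper edge coloring $f$ and colors $a,b$, $G_f(a,b)$ is the subgraph induced by the edges colored $a$ or $b$. An interchange (Kempe change) consists of swapping colors $a$ and $b$ on one connected component of $G_f(a,b)$. *)

(* Defs.v *)
From Stdlib Require Import Relations.
From mathcomp Require Import all_boot.
Set Implicit Arguments. Unset Strict Implicit. Unset Printing Implicit Defensive.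

Definition simple_graph (T : finType) (e : rel T) : Prop :=
  symmetric e /\ irreflexive e.

Definition is_edge (T : finType) (e : rel T) (A : {set T}) : bool :=
  [exists x, exists y, e x y && (A == [set x; y])].

Definition edge (T : finType) (e : rel T) := {A : {set T} | is_edge e A}.

Definition regular (T : finType) (e : rel T) (d : nat) : Prop :=
  forall x : T, #|[set y | e x y]| = d.

Definition adjacent_edges (T : finType) (e : rel T) (g h : edge e) : bool :=
  (g != h) && [exists x, (x \in val g) && (x \in val h)].

(* proper k-edge coloring with colors 'I_k (colors 1..k of the paper are 0..k-1) *)
Definition proper_coloring (T : finType) (e : rel T) (k : nat)
    (f : {ffun edge e -> 'I_k}) : Prop :=
  forall g h : edge e, adjacent_edges g h -> f g != f h.

Definition chromatic_index_is (T : finType) (e : rel T) (t : nat) : Prop :=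
  (exists f : {ffun edge e -> 'I_t}, proper_coloring f) /\
  (forall t', t' < t -> ~ exists f : {ffun edge e -> 'I_t'}, proper_coloring f).

Definition kempe_rel (T : finType) (e : rel T) (k : nat)
    (f : {ffun edge e -> 'I_k}) (a b : 'I_k) : rel T :=
  fun x y => [exists g : edge e,
     [&& x \in val g, y \in val g, x != y & (f g == a) || (f g == b)]].

Definition swap_col (k : nat) (a b c : 'I_k) : 'I_k :=
  if c == a then b else if c == b then a else c.

Definition interchange (T : finType) (e : rel T) (k : nat)
    (f : {ffun edge e -> 'I_k}) (a b : 'I_k) (v : T) : {ffun edge e -> 'I_k} :=
  [ffun g => if ((f g == a) || (f g == b)) &&
                (val g \subset [set u | connect (kempe_rel f a b) v u])
             then swap_col a b (f g) else f g].

Definition kempe_step (T : finType) (e : rel T) (k : nat)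
    (f f' : {ffun edge e -> 'I_k}) : Prop :=
  exists (a b : 'I_k) (v : T), f' = interchange f a b v.

Definition kempe_reachable (T : finType) (e : rel T) (k : nat)
    (f f' : {ffun edge e -> 'I_k}) : Prop :=
  clos_refl_trans _ (@kempe_step T e k) f f'.

(* Main.v *)
Require Import Defs.
From Stdlib Require Import Relations Classical.
From mathcomp Require Import all_boot zify.

(* For a proper 5-edge coloring of a 4-regular graph every vertex misses exactly
   one color.  Fix a color o and a color class M of the 4-edge coloring g, and
   pick, in the Kempe class of the given coloring, one minimizing the symmetric
   difference of M and the class of o.  Call an edge ugly if it has color o but
   is not in M, bad if it is in M but does not have color o, and a vertex free if
   it misses o.  A Vizing fan at an end of an ugly edge reaches a free vertex y,
   whose M-edge xy is then bad, and x carries an ugly edge xz.  Let a and b be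
   missing at x and z, let e be the color of xy, and let zr have color e.  Any
   Kempe change making z miss e, or making r miss o or b, decreases the symmetric
   difference, so r misses the fifth color g.  If q is the other end of the
   o-edge at r, chains of four or five vertices through q, r, z, x, y yield an
   equally good coloring with (r, q, z) in the role of (x, y, z), and comparing
   the two configurations gives a contradiction.  Hence the class of o becomes M;
   the argument only swaps colors whose classes are not settled yet, so the four
   classes of g are reached one after the other. *)

Set Implicit Arguments. Unset Strict Implicit. Unset Printing Implicit Defensive.

(** * Components of the graph of two involutions *)

Section ThreeEnds.
Variables (T : finType) (al be : T -> T).
Hypotheses (alK : involutive al) (beK : involutive be).

Definition alt_rel : rel T := fun u v => (v == al u) || (v == be u).

Lemma alt_rel_sym : symmetric alt_rel.
Proof.
move=> u v; rewrite /alt_rel.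
by congr (_ || _); apply/eqP/eqP => ->; rewrite ?alK ?beK.
Qed.

(* The component of [x] is a single orbit of [al \o be], on which [al] acts as
   k |-> -k and [be] as k |-> -k-1 modulo its length. *)
Lemma orbit_end (x v : T) : al x = x -> connect alt_rel x v ->
  v != x -> al v = v \/ be v = v ->
  findex (al \o be) x v = (order (al \o be) x)./2 /\ fconnect (al \o be) x v.
Proof.
move=> alx; set rho := al \o be.
have rhoI : injective rho by apply: inj_comp; apply: can_inj; [exact: alK | exact: beK].
have alE k : iter k rho (al (iter k rho x)) = x.
  have step u : rho (al (rho u)) = al u by rewrite /rho /= alK beK.
  by elim: k => [|k IH] //; rewrite [in al _]iterS iterSr step.
have fsym := fconnect_sym rhoI.
have al_cl u : fconnect rho x u -> fconnect rho x (al u).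
  move=> xu; rewrite fsym -(alE (findex rho x u)) iter_findex //.
  exact: fconnect_iter.
have be_cl u : fconnect rho x u -> fconnect rho x (be u).
  move=> xu; have -> : be u = al (rho u) by rewrite /rho /= alK.
  by apply: al_cl; apply: connect_trans xu (fconnect1 _ _).
move=> xv; have {}xv : fconnect rho x v.
  have cl : closed alt_rel (fconnect rho x).
    apply: intro_closed => [|u w]; first exact: sym_connect_sym alt_rel_sym.
    by move=> /orP[]/eqP-> /= ?; [apply: al_cl | apply: be_cl].
  by have := closed_connect cl xv; rewrite -!topredE /= connect0 => <-.
move=> vx vend; split=> //.
have kn := findex_max xv; have kx := iter_findex xv.
move: kn kx; set k := findex rho x v; set n := order rho x => kn kx.
have k0 : 0 < k.
  by rewrite lt0n; apply/eqP => k0; move: vx; rewrite -kx k0 eqxx.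
(* The return times to [x] are the multiples of [n], and only [n] lies strictly between 0 and
   [n.*2]. *)
have per j : 0 < j < n.*2 -> iter j rho x = x -> j = n.
  move=> /andP[j0 jn] jx.
  have small i : i < n -> iter i rho x = x -> i = 0.
    by move=> lin ix; rewrite -(findex_iter lin) ix findex0.
  case: (ltnP j n) => [/small/(_ jx)|nj]; first by lia.
  have : j - n = 0; last by lia.
  apply: small; first by lia.
  by rewrite -{2}jx -{2}(subnK nj) iterD iter_order.
(* A fixed point of [al] has [2k = 0] and a fixed point of [be] has [2k + 1 = 0] modulo [n]; the
   parity of [n] decides which, and [k] is [n./2] either way. *)
have : k.*2 = n \/ k.*2.+1 = n.
  case: vend => ve; [left|right]; apply: per; try lia.
    by rewrite -addnn iterD kx -[in LHS]ve -kx alE.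
  have bv : al (rho v) = v by rewrite /rho /= alK.
  have := alE k.+1; rewrite [in al _]iterS kx bv => h.
  by rewrite -[in RHS]h -addnn -addSn iterD kx.
by lia.
Qed.

End ThreeEnds.

(** A component with an end is a path: by [orbit_end] any second end sits at half the length of the
    orbit of [x], so [z] and [w] have the same index. *)
Lemma three_ends (T : finType) (al be : T -> T) (x z w : T) :
  involutive al -> involutive be ->
  al x = x \/ be x = x -> al z = z \/ be z = z -> al w = w \/ be w = w ->
  z != x -> w != x -> connect (alt_rel al be) x z ->
  connect (alt_rel al be) x w -> z = w.
Proof.
wlog xe : al be / al x = x.
  move=> h aK bK [xe|xe] ze we zx wx xz xw; first by apply: (h al be) => //; left.
  have E : alt_rel al be =2 alt_rel be al by move=> u v; exact: orbC.
  apply: (h be al) => //; rewrite -?(eq_connect E) //; first by left.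
    by case: ze; [right|left].
  by case: we; [right|left].
move=> aK bK _ ze we zx wx xz xw.
have [iz cz] := orbit_end aK bK xe xz zx ze.
have [iw cw] := orbit_end aK bK xe xw wx we.
by rewrite -(iter_findex cz) iz -iw iter_findex.
Qed.

(** * Swaps of two colors for families of involutions *)

(** Such a [K] is a union of components of the colors [a] and [b], so a swap on it may stand for
    several Kempe changes at once. *)
Definition kclosed (T : finType) (phi : 'I_5 -> T -> T) (a b : 'I_5) (K : {set T}) :=
  forall v, v \in K -> phi a v \in K /\ phi b v \in K.

Definition kswap (T : finType) (phi : 'I_5 -> T -> T) (a b : 'I_5) (K : {set T}) :=
  fun c v => if v \in K then phi (swap_col a b c) v else phi c v.

Lemma swap_colL k (a b : 'I_k) : swap_col a b a = b.
Proof. by rewrite /swap_col eqxx. Qed.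

Lemma swap_colR k (a b : 'I_k) : swap_col a b b = a.
Proof. by rewrite /swap_col eqxx; case: eqP => // ->. Qed.

Lemma swap_colN k (a b c : 'I_k) : c <> a -> c <> b -> swap_col a b c = c.
Proof. by move=> /eqP/negPf ca /eqP/negPf cb; rewrite /swap_col ca cb. Qed.

Lemma all_colors (s : seq 'I_5) : uniq s -> size s = 5 -> forall c, c \in s.
Proof.
move=> us ss c; have sub : {subset s <= enum 'I_5} by move=> d _; rewrite mem_enum.
have [] := uniq_min_size us sub; first by rewrite ss size_enum_ord.
by move=> _ ->; rewrite mem_enum.
Qed.

(** If [x] and [z] are not connected, the component of [x] serves; if they are, they are the two
    ends of their path, and the component of [w] avoids both. *)
Lemma missing_component (T : finType) (phi : 'I_5 -> T -> T) a b x z w :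
  involutive (phi a) -> involutive (phi b) ->
  phi a x = x \/ phi b x = x -> phi a z = z \/ phi b z = z ->
  phi a w = w \/ phi b w = w -> z <> x -> w <> x -> w <> z ->
  exists2 K : {set T}, kclosed phi a b K &
    (x \in K /\ z \notin K) \/ [/\ w \in K, x \notin K & z \notin K].
Proof.
move=> aK bK xe ze we /eqP zx /eqP wx /eqP wz.
have csym := sym_connect_sym (alt_rel_sym aK bK).
have cl u : kclosed phi a b [set v | connect (alt_rel (phi a) (phi b)) u v].
  move=> v; rewrite !inE => uv.
  by split; apply: connect_trans uv (connect1 _); rewrite /alt_rel eqxx ?orbT.
case: (boolP (connect (alt_rel (phi a) (phi b)) x z)) => xz; last first.
  exists [set v | connect (alt_rel (phi a) (phi b)) x v]; first exact: cl.
  by left; rewrite !inE connect0.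
exists [set v | connect (alt_rel (phi a) (phi b)) w v]; first exact: cl.
right; rewrite !inE connect0.
have xw : ~~ connect (alt_rel (phi a) (phi b)) w x.
  rewrite csym; apply/negP => xw.
  by move: wz; rewrite (three_ends aK bK xe ze we zx wx xz xw) eqxx.
split=> //; apply: contra xw => wz'; apply: connect_trans wz' _.
by rewrite csym.
Qed.

Ltac distinct := rewrite /= ?inE ?negb_or; repeat (apply/andP; split) => //;
  try (apply/eqP; congruence).

(** * Matching one color class *)

(* A coloring is a family [phi] of involutions: [phi c v] is the neighbor of [v]
   along its edge of color [c], and [v] itself if [v] misses [c].  Colors that
   are not [live] belong to classes already settled, [o] is the color to be
   treated next, and [mu] sends a vertex to its partner in the target class. *)
Section MatchColorClass.

Variables (T : finType) (live : pred 'I_5) (o : 'I_5) (mu : T -> T).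
Variable P : ('I_5 -> T -> T) -> Prop.
Hypothesis live_o : live o.
Hypothesis muK : involutive mu.
Hypothesis mu_neq : forall v, mu v <> v.
Hypothesis phiK : forall phi, P phi -> forall c, involutive (phi c).
Hypothesis phi_simple : forall phi, P phi ->
  forall c d v, phi c v = phi d v -> phi c v <> v -> c = d.
Hypothesis phi_missing : forall phi, P phi -> forall v,
  exists2 c, live c & phi c v = v.
Hypothesis phi_missing_uniq : forall phi, P phi -> forall c d v,
  phi c v = v -> phi d v = v -> c = d.
Hypothesis phi_mu : forall phi, P phi -> forall v, exists2 c, live c & phi c v = mu v.
Hypothesis P_swap : forall phi a b K, P phi -> live a -> live b ->
  kclosed phi a b K -> P (kswap phi a b K).

Implicit Types (K : {set T}) (phi psi : 'I_5 -> T -> T) (a b c d e g : 'I_5) (x y z v w : T).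

(* Twice the size of the symmetric difference of the matchings [mu] and
   [phi o], spread over the vertices. *)
Definition weight phi v :=
  if phi o v == mu v then 0 else if phi o v == v then 1 else 2.
Definition total_weight phi := \sum_v weight phi v.
Definition optimal phi :=
  P phi /\ forall psi, P psi -> total_weight phi <= total_weight psi.

Lemma weight0 phi v : phi o v = mu v -> weight phi v = 0.
Proof. by rewrite /weight => ->; rewrite eqxx. Qed.

Lemma weight1 phi v : phi o v = v -> weight phi v = 1.
Proof.
rewrite /weight => ->; rewrite eqxx; case: eqP => // E.
by case: (mu_neq (esym E)).
Qed.

Lemma weight2 phi v : phi o v <> v -> phi o v <> mu v -> weight phi v = 2.
Proof. by rewrite /weight => /eqP/negPf-> /eqP/negPf->. Qed.

Lemma weight_le2 phi v : weight phi v <= 2.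
Proof. by rewrite /weight; case: eqP => //; case: eqP. Qed.

Lemma total_weight_split phi (s : seq T) : uniq s ->
  total_weight phi = \sum_(v <- s) weight phi v + \sum_(v | v \notin s) weight phi v.
Proof. by move=> us; rewrite /total_weight (bigID (mem s)) /= -big_uniq. Qed.

Lemma total_weight_rest phi psi (s : seq T) :
  (forall v, v \notin s -> psi o v = phi o v) ->
  \sum_(v | v \notin s) weight psi v = \sum_(v | v \notin s) weight phi v.
Proof. by move=> h; apply: eq_bigr => v /h E; rewrite /weight E. Qed.

(** Both colorings have the same [o]-edges off [s], so minimality can be tested on [s] alone. *)
Lemma optimal_le phi psi (s : seq T) : optimal phi -> P psi -> uniq s ->
  (forall v, v \notin s -> psi o v = phi o v) ->
  \sum_(v <- s) weight phi v <= \sum_(v <- s) weight psi v.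
Proof.
move=> [_ h] /h + us same.
by rewrite !(total_weight_split _ us) (total_weight_rest same) leq_add2r.
Qed.

Lemma optimal_eq phi psi (s : seq T) : optimal phi -> P psi -> uniq s ->
  (forall v, v \notin s -> psi o v = phi o v) ->
  \sum_(v <- s) weight psi v <= \sum_(v <- s) weight phi v -> optimal psi.
Proof.
move=> [_ h] Ppsi us same le; split=> // rho /h; apply: leq_trans.
by rewrite !(total_weight_split _ us) (total_weight_rest same) leq_add2r.
Qed.

Lemma kswap_out phi a b K c v : v \notin K -> kswap phi a b K c v = phi c v.
Proof. by rewrite /kswap => /negPf->. Qed.

Lemma kswap_inL phi a b K v : v \in K -> kswap phi a b K a v = phi b v.
Proof. by rewrite /kswap => ->; rewrite swap_colL. Qed.

Lemma kswap_inR phi a b K v : v \in K -> kswap phi a b K b v = phi a v.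
Proof. by rewrite /kswap => ->; rewrite swap_colR. Qed.

Lemma kswap_other phi a b K c v : c <> a -> c <> b ->
  kswap phi a b K c v = phi c v.
Proof. by move=> ca cb; rewrite /kswap swap_colN //; case: ifP. Qed.

Ltac kswap_solve := solve
  [ done | congruence
  | rewrite kswap_other; congruence
  | rewrite kswap_out; solve [done | congruence]
  | rewrite kswap_inL; solve [done | congruence]
  | rewrite kswap_inR; solve [done | congruence] ].

Lemma optimal_kswap phi a b K : optimal phi -> live a -> live b ->
  a <> o -> b <> o -> kclosed phi a b K -> optimal (kswap phi a b K).
Proof.
move=> oph la lb ao bo cl; have Pn := P_swap oph.1 la lb cl.
apply: (optimal_eq oph Pn (s := [::])) => //; last by rewrite !big_nil.
by move=> v _; rewrite kswap_other //; congruence.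
Qed.

Lemma missing_live phi c v : optimal phi -> phi c v = v -> live c.
Proof.
move=> [Pp _] cv; have [d ld dv] := phi_missing Pp v.
by rewrite (phi_missing_uniq Pp cv dv).
Qed.

Lemma missing phi v : optimal phi -> exists c, phi c v = v.
Proof. by move=> [Pp _]; have [c _ cv] := phi_missing Pp v; exists c. Qed.

Lemma missing1 phi c d v : optimal phi -> phi c v = v -> phi d v = v -> c = d.
Proof. by move=> [Pp _]; apply: phi_missing_uniq. Qed.

Lemma optK phi c v w : optimal phi -> phi c v = w -> phi c w = v.
Proof. by move=> [Pp _] <-; apply: phiK. Qed.

Lemma opt_simple phi c d v w : optimal phi -> phi c v = w -> phi d v = w ->
  w <> v -> c = d.
Proof. by move=> [Pp _] cv dv wv; apply: (phi_simple Pp (v := v)); congruence. Qed.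

Lemma mu_color_live phi c v : optimal phi -> phi c v = mu v -> live c.
Proof.
move=> oph cv; have [d ld dv] := phi_mu oph.1 v.
by rewrite (opt_simple oph cv dv (@mu_neq v)).
Qed.

Lemma optimal_chain_le phi c (s : seq T) : optimal phi -> live c ->
  kclosed phi o c [set u in s] -> uniq s ->
  \sum_(v <- s) weight phi v <= \sum_(v <- s) weight (kswap phi o c [set u in s]) v.
Proof.
move=> oph lc cl us; apply: optimal_le => //; first exact: P_swap oph.1 live_o lc cl.
by move=> u nu; rewrite kswap_out // inE.
Qed.

(** * Local patterns excluded by optimality *)

(** Otherwise recoloring the edge from [v] to [mu v] with [o] lowers the weight from 2 to 0. *)
Lemma no_free_pair phi v : optimal phi -> phi o v = v -> phi o (mu v) <> mu v.
Proof.
move=> oph ov ow; set w := mu v in ow *.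
have wv : w <> v by apply: mu_neq.
have [c lc cv] := phi_mu oph.1 v; rewrite -/w in cv.
have cw := optK oph cv.
have cl : kclosed phi o c [set u in [:: v; w]].
  by move=> u; rewrite !inE => /orP[]/eqP->; rewrite ?ov ?ow ?cv ?cw !eqxx ?orbT.
have us : uniq [:: v; w] by distinct.
have := optimal_chain_le oph lc cl us.
have Kv : v \in [set u in [:: v; w]] by rewrite !inE eqxx.
have Kw : w \in [set u in [:: v; w]] by rewrite !inE eqxx orbT.
rewrite !big_cons !big_nil (weight1 ov) (weight1 ow).
by rewrite !weight0 ?kswap_inL // ?cw ?muK.
Qed.

(** Recoloring the ugly edge [xz] with [c] would lower the weight of its ends from 4 to 2. *)
Lemma ugly_no_common phi c x z : optimal phi -> phi o x = z -> z <> x ->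
  mu x <> z -> phi c x = x -> phi c z = z -> False.
Proof.
move=> oph ox zx mx cx cz; have oz := optK oph ox.
have lc := missing_live oph cx.
have mz : mu z <> x by move=> E; apply: mx; rewrite -E muK.
have cl : kclosed phi o c [set u in [:: x; z]].
  by move=> u; rewrite !inE => /orP[]/eqP->; rewrite ?ox ?oz ?cx ?cz !eqxx ?orbT.
have us : uniq [:: x; z] by distinct.
have := optimal_chain_le oph lc cl us.
have Kx : x \in [set u in [:: x; z]] by rewrite !inE eqxx.
have Kz : z \in [set u in [:: x; z]] by rewrite !inE eqxx orbT.
have ux : weight phi x = 2 by apply: weight2; congruence.
have uz : weight phi z = 2 by apply: weight2; congruence.
by rewrite !big_cons !big_nil ux uz !weight1 ?kswap_inL.
Qed.

Lemma push phi a b x z w : optimal phi -> live a -> live b -> a <> o -> b <> o ->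
  phi a x = x \/ phi b x = x -> phi a z = z \/ phi b z = z ->
  phi a w = w \/ phi b w = w -> z <> x -> w <> x -> w <> z ->
  exists2 K : {set T}, optimal (kswap phi a b K) &
    (x \in K /\ z \notin K) \/ [/\ w \in K, x \notin K & z \notin K].
Proof.
move=> oph la lb ao bo xe ze we zx wx wz.
have [K cl h] := missing_component (phiK oph.1 a) (phiK oph.1 b) xe ze we zx wx wz.
by exists K => //; apply: optimal_kswap.
Qed.

(* The chain joining the two ends of an ugly edge [xz] leaves every other
   vertex [w] missing [a] on a chain of its own. *)
Lemma push_ugly phi a b x z w : optimal phi -> phi o x = z -> z <> x ->
  mu x <> z -> phi a x = x -> phi b z = z -> phi a w = w -> w <> x ->
  exists K : {set T}, [/\ optimal (kswap phi a b K), w \in K, x \notin K & z \notin K].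
Proof.
move=> oph ox zx mx ax bz aw wx; have oz := optK oph ox.
have wz : w <> z by move=> E; apply: (ugly_no_common oph ox zx mx ax); congruence.
have ao : a <> o by congruence.
have bo : b <> o by congruence.
have [K oK [[xK zK]|[wK xK zK]]] := push oph (missing_live oph ax)
  (missing_live oph bz) ao bo (or_introl ax) (or_intror bz) (or_introl aw) zx wx wz;
  last by exists K.
(* A swap reaching [x] but not [z] would leave both ends of the ugly edge missing [b]. *)
exfalso; apply: (@ugly_no_common _ b x z oK) => //.
- by rewrite kswap_other //; congruence.
- by rewrite kswap_inR.
by rewrite kswap_out.
Qed.

Lemma recolor phi c d u v : optimal phi -> live c -> c <> o -> d <> o ->
  phi c u = v -> phi d u = u -> phi d v = v ->
  exists psi, [/\ optimal psi, psi c u = u, psi c v = v, psi d u = v &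
    (forall w k, w <> u -> w <> v -> psi k w = phi k w) /\
    (forall w k, k <> c -> k <> d -> psi k w = phi k w)].
Proof.
move=> oph lc co do_ cu du dv; have cv := optK oph cu.
exists (kswap phi c d [set u; v]); split; rewrite ?kswap_inL ?kswap_inR ?inE ?eqxx ?orbT //.
  apply: optimal_kswap => //; first exact: missing_live du.
  by move=> w; rewrite !inE => /orP[]/eqP->; rewrite ?cu ?cv ?du ?dv !eqxx ?orbT.
split=> [w k wu wv|w k kc kd]; last by rewrite kswap_other.
by rewrite kswap_out //; distinct.
Qed.

(** Recoloring the [a]-edge at [z] with [b] would leave both ends of the ugly edge missing [a]. *)
Lemma shift_to_missing phi a b x z : optimal phi -> phi o x = z -> z <> x ->
  mu x <> z -> phi a x = x -> phi b z = z -> phi b (phi a z) = phi a z -> False.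
Proof.
move=> oph ox zx mx ax bz bs.
have oz := optK oph ox.
have az : phi a z <> z by move=> az; apply: (ugly_no_common oph ox zx mx ax az).
set s := phi a z in az bs; have as_ : phi a s = z by apply: optK oph (erefl _).
have [psi [opsi psiaz _ _ [out _]]] : exists psi, [/\ optimal psi, psi a z = z,
    psi a s = s, psi b z = s & (forall w k, w <> z -> w <> s -> psi k w = phi k w) /\
    (forall w k, k <> a -> k <> b -> psi k w = phi k w)].
  by apply: recolor => //; [exact: missing_live ax | congruence | congruence].
have sx : s <> x by congruence.
have xz : x <> z by congruence.
have xs : x <> s by congruence.
apply: (@ugly_no_common psi a x z) => //; rewrite out //.
Qed.

(* A Vizing fan centred at [z] that starts with the ugly edge [xz] can only
   stop at a vertex missing [o]. *)
Lemma exists_free phi x : optimal phi -> phi o x <> mu x ->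
  exists v, phi o v = v.
Proof.
move=> oph mx0; case: (boolP [exists v, phi o v == v]) => [/existsP[v /eqP]|]; first by exists v.
move=> /existsPn nof0; exfalso.
have nof v : phi o v <> v by apply/eqP.
have [z ox] : exists z, phi o x = z by exists (phi o x).
have zx : z <> x by move: (nof x); congruence.
have mx : mu x <> z by congruence.
have oz := optK oph ox.
have [a ax] := missing x oph; have [b bz] := missing z oph.
have ao : a <> o by congruence.
have bo : b <> o by congruence.
have ab : a <> b by move=> E; apply: (ugly_no_common oph ox zx mx ax); congruence.
have la := missing_live oph ax; have lb := missing_live oph bz.
have [s az] : exists s, phi a z = s by exists (phi a z).
have sz : s <> z by move=> E; apply: ab; apply: (missing1 oph (v := z)); congruence.
have as_ := optK oph az.
have [c cs] := missing s oph.
have lc := missing_live oph cs.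
have co : c <> o by move: (nof s); congruence.
have ca : c <> a by congruence.
have cb : c <> b.
  by move=> E; apply: (shift_to_missing oph ox zx mx ax bz); congruence.
have [q cz] : exists q, phi c z = q by exists (phi c z).
have qz : q <> z by move=> E; apply: cb; apply: (missing1 oph (v := z)); congruence.
have cq := optK oph cz.
have qx : q <> x.
  by move=> E; apply: co; apply: (opt_simple oph (v := z) (w := x)); congruence.
(* Second fan step: recoloring [zq] from [c] to [b] makes [z] miss [c], as [s] does, so
   [shift_to_missing] applies with [c] for [b]. A general [psi] allows a swap beforehand. *)
have shift2 psi : optimal psi -> psi o x = z -> psi a x = x -> psi a z = s ->
    psi c s = s -> psi c z = q -> psi b z = z -> psi b q = q -> False.
  move=> opsi ox' ax' az' cs' cz' bz' bq'.
  have [rho [orho rcz _ _ [out other]]] := recolor opsi lc co bo cz' bz' bq'.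
  have sq : s <> q.
    by move=> E; apply: ca; apply: (opt_simple opsi (v := z) (w := s)); congruence.
  apply: (shift_to_missing orho (a := a) (b := c) (x := x) (z := z)) => //.
  - by rewrite out //; congruence.
  - by rewrite out //; congruence.
  have -> : rho a z = s by rewrite other //; congruence.
  by rewrite out.
have [d dq] := missing q oph.
have ld := missing_live oph dq.
have do_ : d <> o by move: (nof q); congruence.
have dc : d <> c by congruence.
have db : d <> b by move=> E; apply: (shift2 phi) => //; congruence.
have da : d <> a.
  move=> E; rewrite {}E in dq.
  have [K [oK qK xK zK]] := push_ugly oph ox zx mx ax bz dq qx.
  by apply: (shift2 _ oK); kswap_solve.
have [t dz] : exists t, phi d z = t by exists (phi d z).
have tz : t <> z by move=> E; apply: db; apply: (missing1 oph (v := z)); congruence.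
have dt := optK oph dz.
have tx : t <> x.
  by move=> E; apply: do_; apply: (opt_simple oph (v := z) (w := x)); congruence.
have ts : t <> s.
  by move=> E; apply: da; apply: (opt_simple oph (v := z) (w := s)); congruence.
have tq : t <> q.
  by move=> E; apply: dc; apply: (opt_simple oph (v := z) (w := q)); congruence.
have sq : s <> q.
  by move=> E; apply: ca; apply: (opt_simple oph (v := z) (w := s)); congruence.
(* Third fan step: recolor [zt] from [d] to [b], then [zq] from [c] to [d]; again both [z] and [s]
   miss [c]. *)
have shift3 psi : optimal psi -> psi o x = z -> psi a x = x -> psi a z = s ->
    psi c s = s -> psi c z = q -> psi d q = q -> psi d z = t ->
    psi b z = z -> psi b t = t -> False.
  move=> opsi ox' ax' az' cs' cz' dq' dz' bz' bt'.
  have [rho [orho rdz _ _ [out other]]] := recolor opsi ld do_ bo dz' bz' bt'.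
  have [rho' [orho' rcz _ _ [out' other']]] : exists psi, [/\ optimal psi, psi c z = z,
    psi c q = q, psi d z = q & (forall w k, w <> z -> w <> q -> psi k w = rho k w) /\
    (forall w k, k <> c -> k <> d -> psi k w = rho k w)].
    apply: recolor => //; first by rewrite other //; congruence.
    by rewrite out //; congruence.
  apply: (shift_to_missing orho' (a := a) (b := c) (x := x) (z := z)) => //.
  - by rewrite out' ?out //; congruence.
  - by rewrite out' ?out //; congruence.
  have -> : rho' a z = s by rewrite other' ?other //; congruence.
  by rewrite out' ?out //; congruence.
have [c' ct] := missing t oph.
have c'o : c' <> o by move: (nof t); congruence.
have c'd : c' <> d by congruence.
have c'b : c' <> b by move=> E; apply: (shift3 phi) => //; congruence.
have c'a : c' <> a.
  move=> E; rewrite {}E in ct.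
  have [K [oK tK xK zK]] := push_ugly oph ox zx mx ax bz ct tx.
  by apply: (shift3 _ oK); kswap_solve.
have c'c : c' <> c.
  move=> E; rewrite {}E in ct.
  (* Both [s] and [t] miss [c] while [z] misses [b]: a swap of [c] and [b] either makes [s] miss [b]
     without touching [z], or makes [t] miss [b] without touching [s] and [z]. *)
  have [K oK [[sK zK]|[tK sK zK]]] := push oph lc lb co bo (or_introl cs)
    (or_intror bz) (or_introl ct) (nesym sz) ts tz.
    apply: (shift_to_missing oK (a := a) (b := b) (x := x) (z := z)) => //.
    - by rewrite kswap_other //; congruence.
    - by rewrite kswap_other //; congruence.
    - by rewrite kswap_out.
    by rewrite (kswap_out _ _ _ _ zK) az kswap_inR.
  by apply: (shift3 _ oK); kswap_solve.
(* These are all five colors, and the color [c'] missing at [t] is none of them. *)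
have us : uniq [:: o; a; b; c; d] by distinct.
have := all_colors us erefl c'.
rewrite !inE => /orP[/eqP //|/orP[/eqP //|/orP[/eqP //|/orP[/eqP //|/eqP //]]]].
Qed.

(** * Configurations of a bad edge and an ugly edge *)

(* [y] is free, [xy] is a bad edge of color [e], and [xz] is an ugly edge whose
   ends [x] and [z] miss [a] and [b]. *)
Record config phi x y z a b e : Prop := Config {
  cfg_opt : optimal phi;
  cfg_mu : mu x = y;
  cfg_free : phi o y = y;
  cfg_ugly : phi o x = z;
  cfg_neq : z <> x;
  cfg_a : phi a x = x;
  cfg_b : phi b z = z;
  cfg_e : phi e x = y }.

(** Otherwise [y - x - z] is a full chain of the colors [o] and [e], and swapping it lowers its
    weight from 5 to 1. *)
Lemma config_missing_e phi x y z e : optimal phi -> mu x = y -> phi o y = y ->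
  phi o x = z -> z <> x -> phi e x = y -> phi e z <> z.
Proof.
move=> oph mx oy ox zx ex ez; have oz := optK oph ox; have ey := optK oph ex.
have my : mu y = x by rewrite -mx muK.
have le : live e by apply: (mu_color_live oph (v := x)); congruence.
have mz : mu z <> x by move=> E; have := muK z; congruence.
have us : uniq [:: x; y; z] by distinct.
have cl : kclosed phi o e [set u in [:: x; y; z]].
  by move=> u; rewrite !inE => /or3P[]/eqP->;
    rewrite ?ox ?oy ?oz ?ex ?ey ?ez !eqxx ?orbT.
have := optimal_chain_le oph le cl us.
have Kx : x \in [set u in [:: x; y; z]] by rewrite !inE eqxx.
have Ky : y \in [set u in [:: x; y; z]] by rewrite !inE eqxx orbT.
have Kz : z \in [set u in [:: x; y; z]] by rewrite !inE eqxx !orbT.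
have wx : weight phi x = 2 by apply: weight2; congruence.
have wz : weight phi z = 2 by apply: weight2; congruence.
rewrite !big_cons !big_nil wx wz (weight1 oy).
rewrite [weight _ x]weight0; last by kswap_solve.
rewrite [weight _ y]weight0; last by kswap_solve.
by rewrite [weight _ z]weight1; last by kswap_solve.
Qed.

Record config_facts phi x y z a b e : Prop := ConfigFacts {
  fact_oz : phi o z = x;
  fact_ey : phi e y = x;
  fact_muy : mu y = x;
  fact_mux : mu x <> z;
  fact_muz : mu z <> x;
  fact_yx : y <> x;
  fact_yz : y <> z;
  fact_ao : a <> o;
  fact_bo : b <> o;
  fact_eo : e <> o;
  fact_ab : a <> b;
  fact_ea : e <> a;
  fact_eb : e <> b;
  fact_la : live a;
  fact_lb : live b;
  fact_le : live e;
  fact_az : phi a z <> z;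
  fact_ez : phi e z <> z }.

Lemma configP phi x y z a b e : config phi x y z a b e -> config_facts phi x y z a b e.
Proof.
case=> oph mx oy ox zx ax bz ex.
have oz := optK oph ox; have ey := optK oph ex.
have my : mu y = x by rewrite -mx muK.
have yx : y <> x by rewrite -mx; apply: mu_neq.
have mxz : mu x <> z by congruence.
have ez := config_missing_e oph mx oy ox zx ex.
have az : phi a z <> z by move=> az; apply: (ugly_no_common oph ox zx mxz ax az).
split; try congruence.
- exact: missing_live ax.
- exact: missing_live bz.
by apply: (mu_color_live oph (v := x)); congruence.
Qed.

(** With a free [e]-neighbor [r] of [z], swapping [o] and [e] on the full chain [y - x - z - r]
    would lower its weight from 6 to at most 4. *)
Lemma config_e_nbr_not_free phi x y z a b e : config phi x y z a b e ->
  phi o (phi e z) <> phi e z.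
Proof.
move=> cf; have [oph mx oy ox zx ax bz ex] := cf.
have [oz ey my mxz mzx yx yz ao bo eo ab ea eb la lb le az ez] := configP cf.
have [r er] : exists r, phi e z = r by exists (phi e z).
rewrite er in ez *; have rz := optK oph er; move=> or_.
have us : uniq [:: x; y; z; r] by distinct.
have cl : kclosed phi o e [set u in [:: x; y; z; r]].
  by move=> u; rewrite !inE => /or4P[]/eqP->;
    rewrite ?ox ?oy ?oz ?or_ ?ex ?ey ?er ?rz !eqxx ?orbT.
have := optimal_chain_le oph le cl us.
have Kx : x \in [set u in [:: x; y; z; r]] by rewrite !inE eqxx.
have Ky : y \in [set u in [:: x; y; z; r]] by rewrite !inE eqxx orbT.
have wx : weight phi x = 2 by apply: weight2; congruence.
have wz : weight phi z = 2 by apply: weight2; congruence.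
rewrite !big_cons !big_nil wx wz (weight1 oy) (weight1 or_).
rewrite [weight _ x]weight0; last by kswap_solve.
rewrite [weight _ y]weight0; last by kswap_solve.
have := weight_le2 (kswap phi o e [set u in [:: x; y; z; r]]) z.
have := weight_le2 (kswap phi o e [set u in [:: x; y; z; r]]) r.
by clear; lia.
Qed.

(** If [s] is a free [a]-neighbor of [z] other than [y], swapping [o] and [a] on [x - z - s] frees
    [x]; then [xy] can take color [o]. The weight on these four vertices drops from 6 to at most
    4. *)
Lemma config_a_nbr_free phi x y z a b e : config phi x y z a b e ->
  phi o (phi a z) = phi a z -> phi a z = y.
Proof.
move=> cf; have [oph mx oy ox zx ax bz ex] := cf.
have [oz ey my mxz mzx yx yz ao bo eo ab ea eb la lb le az ez] := configP cf.
have [s as_] : exists s, phi a z = s by exists (phi a z).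
rewrite as_ in az *; have sz := optK oph as_; move=> os.
apply/eqP; apply/negP => /negP/eqP sy.
have cl : kclosed phi o a [set u in [:: x; z; s]].
  by move=> u; rewrite !inE => /or3P[]/eqP->;
    rewrite ?ox ?os ?oz ?ax ?as_ ?sz !eqxx ?orbT.
have P1 := P_swap oph.1 live_o la cl.
set psi := kswap _ _ _ _ in P1.
have Kx : x \in [set u in [:: x; z; s]] by rewrite !inE eqxx.
have Kz : z \in [set u in [:: x; z; s]] by rewrite !inE eqxx orbT.
have Ks : s \in [set u in [:: x; z; s]] by rewrite !inE eqxx !orbT.
have Ky : y \notin [set u in [:: x; z; s]] by distinct.
have ox1 : psi o x = x by rewrite /psi; kswap_solve.
have oz1 : psi o z = s by rewrite /psi; kswap_solve.
have os1 : psi o s = z by rewrite /psi; kswap_solve.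
have oy1 : psi o y = y by rewrite /psi; kswap_solve.
have ex1 : psi e x = y by rewrite /psi; kswap_solve.
have ey1 : psi e y = x by rewrite /psi; kswap_solve.
have cl2 : kclosed psi o e [set u in [:: x; y]].
  by move=> u; rewrite !inE => /orP[]/eqP->; rewrite ?ox1 ?oy1 ?ex1 ?ey1 !eqxx ?orbT.
have P2 := P_swap P1 live_o le cl2.
have Kx2 : x \in [set u in [:: x; y]] by rewrite !inE eqxx.
have Ky2 : y \in [set u in [:: x; y]] by rewrite !inE eqxx orbT.
have us : uniq [:: x; y; z; s] by distinct.
have same u : u \notin [:: x; y; z; s] ->
    kswap psi o e [set u in [:: x; y]] o u = phi o u.
  rewrite !inE !negb_or => /and4P[ux uy uz us_].
  rewrite kswap_out; last by rewrite !inE negb_or ux uy.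
  by rewrite /psi kswap_out // !inE !negb_or ux uz us_.
have := optimal_le oph P2 us same.
have wx : weight phi x = 2 by apply: weight2; congruence.
have wz : weight phi z = 2 by apply: weight2; congruence.
rewrite !big_cons !big_nil wx wz (weight1 oy) (weight1 os).
rewrite [weight _ x]weight0; last by kswap_solve.
rewrite [weight _ y]weight0; last by kswap_solve.
have := weight_le2 (kswap psi o e [set u in [:: x; y]]) z.
have := weight_le2 (kswap psi o e [set u in [:: x; y]]) s.
by clear; lia.
Qed.

(* If the [e]-neighbor [r] of [z] missed [b], recoloring [zr] with [b] would
   let [z] miss [e]. *)
Lemma config_e_nbr_not_b phi x y z a b e : config phi x y z a b e ->
  phi b (phi e z) <> phi e z.
Proof.
move=> cf; have [oph mx oy ox zx ax bz ex] := cf.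
have [oz ey my mxz mzx yx yz ao bo eo ab ea eb la lb le az ez] := configP cf.
have [r er] : exists r, phi e z = r by exists (phi e z).
rewrite er in ez *; move=> br; have re := optK oph er.
have [psi [opsi ez1 _ _ [out _]]] := recolor oph le eo bo er bz br.
have rx : r <> x by congruence.
have ry : r <> y by congruence.
apply: (@config_missing_e psi x y z e) => //; rewrite out //; congruence.
Qed.

(** The previous lemmas exclude [o] and [b], and [e] is the color of [zr]. If [r] missed [a],
    [push_ugly] would make it miss [b] and keep the configuration. *)
Lemma config_fourth phi x y z a b e : config phi x y z a b e ->
  exists g, [/\ g <> o, g <> a, g <> b, g <> e & phi g (phi e z) = phi e z].
Proof.
move=> cf; have [oph mx oy ox zx ax bz ex] := cf.
have [oz ey my mxz mzx yx yz ao bo eo ab ea eb la lb le az ez] := configP cf.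
have ornf := config_e_nbr_not_free cf.
have bnr := config_e_nbr_not_b cf.
have [r er] : exists r, phi e z = r by exists (phi e z).
rewrite er in ez ornf bnr *; have rz := optK oph er.
have rx : r <> x by congruence.
have [g gr] := missing r oph.
exists g; split => //; try congruence.
move=> E; rewrite {}E in gr.
have [K [oK rK xK zK]] := push_ugly oph ox zx mxz ax bz gr rx.
have cf' : config (kswap phi a b K) x y z a b e by split => //; kswap_solve.
by apply: (config_e_nbr_not_b cf'); rewrite (kswap_out _ _ _ _ zK) er kswap_inR.
Qed.

(** * Configurations extended by a fourth vertex and the fifth color *)

Record config4 phi x y z r a b e g : Prop := Config4 {
  cfg4 : config phi x y z a b e;
  cfg4_r : phi e z = r;
  cfg4_g : phi g r = r;
  cfg4_uniq : uniq [:: o; a; b; e; g] }.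

Lemma config4_of phi x y z r a b e g : config phi x y z a b e ->
  phi e z = r -> uniq [:: o; a; b; e; g] -> config4 phi x y z r a b e g.
Proof.
move=> cf er us; split => //.
have [g' [g'o g'a g'b g'e]] := config_fourth cf; rewrite er.
by have := all_colors us erefl g'; rewrite !inE => /or4P[/eqP //|/eqP //|/eqP //|/orP[/eqP //|/eqP->]].
Qed.

Record config4_facts phi x y z r a b e g : Prop := Config4Facts {
  fact_go : g <> o;
  fact_ga : g <> a;
  fact_gb : g <> b;
  fact_ge : g <> e;
  fact_rz : r <> z;
  fact_rx : r <> x;
  fact_ry : r <> y;
  fact_er : phi e r = z;
  fact_or : phi o r <> r;
  fact_lg : live g;
  fact_gz : phi g z <> z }.

Lemma config4P phi x y z r a b e g : config4 phi x y z r a b e g ->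
  config4_facts phi x y z r a b e g.
Proof.
case=> cf er gr; rewrite /= !inE !negb_or -!andbA.
move=> /and5P[_ _ _ /eqP og /and5P[_ _ /eqP ag _ /andP[/eqP bg /andP[/eqP eg _]]]].
have [oph mx oy ox zx ax bz ex] := cf.
have [oz ey my mxz mzx yx yz ao bo eo ab ea eb la lb le az ez] := configP cf.
have rz := optK oph er.
have or_ := config_e_nbr_not_free cf; rewrite er in or_.
have lg := missing_live oph gr.
have gz : phi g z <> z by move=> E; apply: bg; apply: (missing1 oph (v := z)).
by split; congruence.
Qed.

(** The chain of the colors [g] and [b] from [r] must end at [z]; if not, swapping it would make [r]
    miss [b]. Hence [w] lies on another chain. *)
Lemma push_from_r phi x y z r a b e g w : config4 phi x y z r a b e g ->
  w <> z -> w <> r -> phi g w = w \/ phi b w = w ->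
  exists K : {set T}, [/\ optimal (kswap phi g b K), w \in K, r \notin K & z \notin K].
Proof.
move=> cf4 wz wr we; have [go ga gb ge rz rx ry re or_ lg gz] := config4P cf4.
case: cf4 => cf er gr _.
have [oph mx oy ox zx ax bz ex] := cf.
have [oz ey my mxz mzx yx yz ao bo eo ab ea eb la lb le az ez] := configP cf.
have [K oK [[rK zK]|[wK rK zK]]] := push oph lg lb go bo (or_introl gr)
    (or_intror bz) we (nesym rz) wr wz; last by exists K.
have cf' : config (kswap phi g b K) x y z a b e by split => //; kswap_solve.
by case: (config_e_nbr_not_b cf'); rewrite (kswap_out _ _ _ _ zK) er kswap_inR.
Qed.

(** Otherwise recolor the [g]-edge at [z] with [b], then [zr] with [g]; now [z] misses [e], against
    [config_missing_e]. *)
Lemma g_nbr_not_b phi x y z r a b e g : config4 phi x y z r a b e g ->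
  phi b (phi g z) <> phi g z.
Proof.
move=> cf4; have [go ga gb ge rz rx ry re or_ lg gz] := config4P cf4.
case: cf4 => cf er gr _.
have [oph mx oy ox zx ax bz ex] := cf.
have [oz ey my mxz mzx yx yz ao bo eo ab ea eb la lb le az ez] := configP cf.
have [t gt] : exists t, phi g z = t by exists (phi g z).
rewrite gt in gz *; move=> bt; have tg := optK oph gt.
have [psi [opsi gz1 _ _ [out other]]] := recolor oph lg go bo gt bz bt.
have [rho [orho ez2 _ _ [out' other']]] : exists rho, [/\ optimal rho, rho e z = z,
    rho e r = r, rho g z = r & (forall w k, w <> z -> w <> r -> rho k w = psi k w) /\
    (forall w k, k <> e -> k <> g -> rho k w = psi k w)].
  apply: recolor => //; first by rewrite other //; congruence.
  by rewrite out //; congruence.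
apply: (@config_missing_e rho x y z e) => //.
- by rewrite other' ?other //; congruence.
- by rewrite other' ?other //; congruence.
by rewrite out' ?other //; congruence.
Qed.

(** By [push_ugly] a [g]-neighbor missing [a] could be made to miss [b]. *)
Lemma g_nbr_not_a phi x y z r a b e g : config4 phi x y z r a b e g ->
  phi a (phi g z) <> phi g z.
Proof.
move=> cf4; have [go ga gb ge rz rx ry re or_ lg gz] := config4P cf4.
case: cf4 => cf er gr us.
have [oph mx oy ox zx ax bz ex] := cf.
have [oz ey my mxz mzx yx yz ao bo eo ab ea eb la lb le az ez] := configP cf.
have [t gt] : exists t, phi g z = t by exists (phi g z).
rewrite gt in gz *; move=> at_; have tg := optK oph gt.
have tx : t <> x.
  by move=> E; apply: go; apply: (opt_simple oph (v := z) (w := x)); congruence.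
have [K [oK tK xK zK]] := push_ugly oph ox zx mxz ax bz at_ tx.
have cf' : config (kswap phi a b K) x y z a b e by split => //; kswap_solve.
have cf4' : config4 (kswap phi a b K) x y z r a b e g by split => //; kswap_solve.
by apply: (g_nbr_not_b cf4'); rewrite (kswap_out _ _ _ _ zK) gt kswap_inR.
Qed.

Lemma g_nbr phi x y z r a b e g : config4 phi x y z r a b e g ->
  phi o (phi g z) = phi g z \/ phi e (phi g z) = phi g z.
Proof.
move=> cf4; have [go ga gb ge rz rx ry re or_ lg gz] := config4P cf4.
have nb := g_nbr_not_b cf4; have na := g_nbr_not_a cf4.
case: cf4 => cf er gr us; have [oph _ _ _ _ _ _ _] := cf.
have tg := optK oph (erefl (phi g z)).
have [c ct] := missing (phi g z) oph.
have := all_colors us erefl c; rewrite !inE.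
by move=> /or4P[/eqP E|/eqP E|/eqP E|/orP[/eqP E|/eqP E]]; rewrite E in ct;
  [left | | | right | congruence].
Qed.

(** The color [a] is present there, [b] is excluded by [shift_to_missing], and [g] could be turned
    into [b] by [push_from_r]. *)
Lemma a_nbr phi x y z r a b e g : config4 phi x y z r a b e g ->
  phi o (phi a z) = phi a z \/ phi e (phi a z) = phi a z.
Proof.
move=> cf4; have [go ga gb ge rz rx ry re or_ lg gz] := config4P cf4.
have [cf er gr us] := cf4.
have [oph mx oy ox zx ax bz ex] := cf.
have [oz ey my mxz mzx yx yz ao bo eo ab ea eb la lb le az ez] := configP cf.
have [s as_] : exists s, phi a z = s by exists (phi a z).
rewrite as_ in az *; have sa := optK oph as_.
have [c cs] := missing s oph.
have := all_colors us erefl c; rewrite !inE.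
move=> /or4P[/eqP E|/eqP E|/eqP E|/orP[/eqP E|/eqP E]]; rewrite E in cs;
  [by left | congruence | | by right | ]; exfalso.
  by apply: (shift_to_missing oph ox zx mxz ax bz); congruence.
have sr : s <> r.
  by move=> E'; apply: ea; apply: (opt_simple oph (v := z) (w := r)); congruence.
have [K [oK sK rK zK]] := push_from_r cf4 az sr (or_introl cs).
apply: (shift_to_missing oK (a := a) (b := b) (x := x) (z := z)) => //; try kswap_solve.
by rewrite (kswap_out _ _ _ _ zK) as_ kswap_inR.
Qed.

(** The two neighbors and [z] are three ends of chains of the colors [e] and [b], so one of the
    neighbors can be made to miss [b] while [z] stays untouched. *)
Lemma not_both_miss_e phi x y z r a b e g : config4 phi x y z r a b e g ->
  phi e (phi a z) = phi a z -> phi e (phi g z) = phi g z -> False.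
Proof.
move=> cf4; have [go ga gb ge rz rx ry re or_ lg gz] := config4P cf4.
have [cf er gr us] := cf4.
have [oph mx oy ox zx ax bz ex] := cf.
have [oz ey my mxz mzx yx yz ao bo eo ab ea eb la lb le az ez] := configP cf.
have [s as_] : exists s, phi a z = s by exists (phi a z).
have [t gt] : exists t, phi g z = t by exists (phi g z).
rewrite as_ gt in az gz *; move=> es et.
have ts : t <> s.
  by move=> E'; apply: ga; apply: (opt_simple oph (v := z) (w := s)); congruence.
have [K oK [[sK zK]|[tK sK zK]]] := push oph le lb eo bo (or_introl es)
    (or_intror bz) (or_introl et) (nesym az) ts gz.
  apply: (shift_to_missing oK (a := a) (b := b) (x := x) (z := z)) => //; try kswap_solve.
  by rewrite (kswap_out _ _ _ _ zK) as_ kswap_inR.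
(* If the swap reaches [x], the bad edge [xy] gets color [b], which [z] misses; if not, the
   configuration survives and [g_nbr_not_b] applies. *)
have [xK|xK] := boolP (x \in K).
  by apply: (@config_missing_e (kswap phi e b K) x y z b) => //; kswap_solve.
have cf' : config (kswap phi e b K) x y z a b e by split => //; kswap_solve.
have cf4' : config4 (kswap phi e b K) x y z r a b e g by split => //; kswap_solve.
by apply: (g_nbr_not_b cf4'); rewrite (kswap_out _ _ _ _ zK) gt kswap_inR.
Qed.

(* Recoloring the edge [rq] of color [o] with [g] makes [r] free, and swapping
   [o] and [e] on [y - x - z - r] then gives the configuration [(r, q, z)], in
   which the [g]-neighbor of [z] must miss [a]. *)
Lemma no_common_g phi x y z r a b e g : config4 phi x y z r a b e g ->
  phi g (phi o r) = phi o r -> False.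
Proof.
move=> cf4; have [go ga gb ge rz rx ry re or_ lg gz] := config4P cf4.
have na := g_nbr_not_a cf4; have [cf er gr us] := cf4.
have [oph mx oy ox zx ax bz ex] := cf.
have [oz ey my mxz mzx yx yz ao bo eo ab ea eb la lb le az ez] := configP cf.
have [q orq] : exists q, phi o r = q by exists (phi o r).
rewrite orq in or_ *; have oq := optK oph orq; move=> gq.
have cl1 : kclosed phi o g [set u in [:: r; q]].
  by move=> u; rewrite !inE => /orP[]/eqP->; rewrite ?orq ?oq ?gr ?gq !eqxx ?orbT.
have P1 := P_swap oph.1 live_o lg cl1.
set psi := kswap _ _ _ _ in P1.
have Kr : r \in [set u in [:: r; q]] by rewrite !inE eqxx.
have Kq : q \in [set u in [:: r; q]] by rewrite !inE eqxx orbT.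
have Kx : x \notin [set u in [:: r; q]] by distinct.
have Ky : y \notin [set u in [:: r; q]] by distinct.
have Kz : z \notin [set u in [:: r; q]] by distinct.
have or1 : psi o r = r by rewrite /psi; kswap_solve.
have oq1 : psi o q = q by rewrite /psi; kswap_solve.
have gr1 : psi g r = q by rewrite /psi; kswap_solve.
have ox1 : psi o x = z by rewrite /psi; kswap_solve.
have oy1 : psi o y = y by rewrite /psi; kswap_solve.
have oz1 : psi o z = x by rewrite /psi; kswap_solve.
have ex1 : psi e x = y by rewrite /psi; kswap_solve.
have ey1 : psi e y = x by rewrite /psi; kswap_solve.
have ez1 : psi e z = r by rewrite /psi; kswap_solve.
have er1 : psi e r = z by rewrite /psi; kswap_solve.
have cl2 : kclosed psi o e [set u in [:: x; y; z; r]].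
  by move=> u; rewrite !inE => /or4P[]/eqP->;
    rewrite ?ox1 ?oy1 ?oz1 ?or1 ?ex1 ?ey1 ?ez1 ?er1 !eqxx ?orbT.
have P2 := P_swap P1 live_o le cl2.
have Jx : x \in [set u in [:: x; y; z; r]] by rewrite !inE eqxx.
have Jy : y \in [set u in [:: x; y; z; r]] by rewrite !inE eqxx orbT.
have Jz : z \in [set u in [:: x; y; z; r]] by rewrite !inE eqxx !orbT.
have Jr : r \in [set u in [:: x; y; z; r]] by rewrite !inE eqxx !orbT.
have Jq : q \notin [set u in [:: x; y; z; r]] by distinct.
have uniq5 : uniq [:: x; y; z; r; q] by distinct.
have same u : u \notin [:: x; y; z; r; q] ->
    kswap psi o e [set u in [:: x; y; z; r]] o u = phi o u.
  rewrite !inE !negb_or => /and5P[ux uy uz ur uq].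
  rewrite kswap_out; last by rewrite !inE !negb_or ux uy uz ur.
  by rewrite /psi kswap_out // !inE negb_or ur uq.
have wx : weight phi x = 2 by apply: weight2; congruence.
have wz : weight phi z = 2 by apply: weight2; congruence.
have wy : weight phi y = 1 by apply: weight1.
have wx2 : weight (kswap psi o e [set u in [:: x; y; z; r]]) x = 0.
  by apply: weight0; kswap_solve.
have wy2 : weight (kswap psi o e [set u in [:: x; y; z; r]]) y = 0.
  by apply: weight0; kswap_solve.
have wq2 : weight (kswap psi o e [set u in [:: x; y; z; r]]) q = 1.
  by apply: weight1; kswap_solve.
have wz2 := weight_le2 (kswap psi o e [set u in [:: x; y; z; r]]) z.
have wr2 := weight_le2 (kswap psi o e [set u in [:: x; y; z; r]]) r.
(* If [rq] is outside the target class, the weight on the five vertices drops from 9 to at most 5.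
   If it is inside, the weight is 5 before and at most 5 after, so the new coloring is optimal
   too. *)
have mr : mu r = q.
  apply/eqP; apply/negP => /negP/eqP mr.
  have wr : weight phi r = 2 by apply: weight2; congruence.
  have wq : weight phi q = 2.
    by apply: weight2; [congruence | have := muK q; congruence].
  have := optimal_le oph P2 uniq5 same.
  rewrite !big_cons !big_nil wx wy wz wr wq wx2 wy2 wq2.
  by move: wz2 wr2; clear; lia.
have wr : weight phi r = 0 by apply: weight0; congruence.
have wq : weight phi q = 0 by apply: weight0; have := muK r; congruence.
have o2 : optimal (kswap psi o e [set u in [:: x; y; z; r]]).
  apply: (optimal_eq oph P2 uniq5 same).
  rewrite !big_cons !big_nil wx wy wz wr wq wx2 wy2 wq2.
  by move: wz2 wr2; clear; lia.
have cf' : config (kswap psi o e [set u in [:: x; y; z; r]]) r q z e b g.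
  split => //; try congruence; try kswap_solve.
  by rewrite kswap_other // /psi; kswap_solve.
have gz' : kswap psi o e [set u in [:: x; y; z; r]] g z = phi g z.
  by rewrite kswap_other // /psi; kswap_solve.
have us' : uniq [:: o; e; b; g; a] by distinct.
have [_ _ at2 _] := config4_of cf' gz' us'.
apply: na; rewrite -[RHS]at2 kswap_other; try congruence.
by rewrite /psi kswap_other //; congruence.
Qed.

(* Swapping [o] and [e] on [q - r - z - x - y] exchanges the roles of [a] and [g];
   the conditions on the [a]- and [g]-neighbors of [z] before and after the swap
   force them to be [y] and [q], which leaves no partner for [z]. *)
Lemma no_e_across_r phi x y z r a b e g : config4 phi x y z r a b e g ->
  phi e (phi o r) = phi o r -> False.
Proof.
move=> cf4; have [go ga gb ge rz rx ry re or_ lg gz] := config4P cf4.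
have [cf er gr us] := cf4.
have [oph mx oy ox zx ax bz ex] := cf.
have [oz ey my mxz mzx yx yz ao bo eo ab ea eb la lb le az ez] := configP cf.
have [q orq] : exists q, phi o r = q by exists (phi o r).
rewrite orq in or_ *; have oq := optK oph orq; move=> eq_.
have [s as_] : exists s, phi a z = s by exists (phi a z).
have [t gt] : exists t, phi g z = t by exists (phi g z).
have sa := optK oph as_; have tg := optK oph gt.
have us5 : uniq [:: q; r; z; x; y] by distinct.
have cl : kclosed phi o e [set u in [:: q; r; z; x; y]].
  move=> u; rewrite !inE => /orP[|/or4P[]]/eqP->;
  by rewrite ?ox ?oy ?oz ?orq ?oq ?ex ?ey ?er ?re ?eq_ !eqxx ?orbT.
have Pn := P_swap oph.1 live_o le cl.
set K := [set u in [:: q; r; z; x; y]] in cl Pn.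
have same u : u \notin [:: q; r; z; x; y] -> kswap phi o e K o u = phi o u.
  by move=> nu; rewrite kswap_out // inE.
have Kq : q \in K by rewrite !inE eqxx.
have Kr : r \in K by rewrite !inE eqxx ?orbT.
have Kz : z \in K by rewrite !inE eqxx ?orbT.
have Kx : x \in K by rewrite !inE eqxx ?orbT.
have Ky : y \in K by rewrite !inE eqxx ?orbT.
have inK u : u \in K -> [\/ u = q, u = r, u = z | u = x \/ u = y].
  rewrite !inE => /orP[/eqP|/or4P[]/eqP]; [exact: Or41 | exact: Or42 | exact: Or43 |
    by move=> ?; apply: Or44; left | by move=> ?; apply: Or44; right].
set psi := kswap phi o e K in Pn same *.
have psiN c v : c <> o -> c <> e -> psi c v = phi c v by exact: kswap_other.
have psio v : v \in K -> psi o v = phi e v by exact: kswap_inL.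
have psie v : v \in K -> psi e v = phi o v by exact: kswap_inR.
have psi_out c v : v \notin K -> psi c v = phi c v by exact: kswap_out.
have wx : weight phi x = 2 by apply: weight2; congruence.
have wz : weight phi z = 2 by apply: weight2; congruence.
have wy : weight phi y = 1 by apply: weight1.
have wx2 : weight psi x = 0 by apply: weight0; rewrite psio //; congruence.
have wy2 : weight psi y = 0 by apply: weight0; rewrite psio //; congruence.
have wq2 : weight psi q = 1 by apply: weight1; rewrite psio //; congruence.
have wz2 := weight_le2 psi z.
have wr2 := weight_le2 psi r.
have mr : mu r = q.
  apply/eqP; apply/negP => /negP/eqP mr.
  have wr : weight phi r = 2 by apply: weight2; congruence.
  have wq : weight phi q = 2.
    by apply: weight2; [congruence | have := muK q; congruence].
  have := optimal_le oph Pn us5 same.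
  rewrite !big_cons !big_nil wx wy wz wr wq wx2 wy2 wq2.
  by move: wz2 wr2; clear; lia.
have wr : weight phi r = 0 by apply: weight0; congruence.
have wq : weight phi q = 0 by apply: weight0; have := muK r; congruence.
have opsi : optimal psi.
  apply: (optimal_eq oph Pn us5 same).
  rewrite !big_cons !big_nil wx wy wz wr wq wx2 wy2 wq2.
  by move: wz2 wr2; clear; lia.
have cf' : config psi r q z g b e.
  by split => //; rewrite ?psio ?psie ?psiN //; congruence.
have us' : uniq [:: o; g; b; e; a] by distinct.
have ez' : psi e z = x by rewrite psie.
have cf4' := config4_of cf' ez' us'.
(* The partner of [z] is one of [x], [s], [r], [t], but [mu] already pairs [x] with [y] and [r] with
   [q]. *)
have zst : ~ ((s = y \/ s = q) /\ (t = y \/ t = q)).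
  have muz : mu q = r by rewrite -mr muK.
  have [c _ cz] := phi_mu oph.1 z.
  have := muK z; have mzz := @mu_neq z.
  have := all_colors us erefl c; rewrite !inE.
  by move=> /or4P[/eqP E|/eqP E|/eqP E|/orP[/eqP E|/eqP E]]; rewrite E in cz;
    move=> ? [[?|?] [?|?]]; congruence.
have S := a_nbr cf4; have G := g_nbr cf4; have SG := not_both_miss_e cf4.
have S' := a_nbr cf4'; have G' := g_nbr cf4'; have SG' := not_both_miss_e cf4'.
have F := config_a_nbr_free cf; have F' := config_a_nbr_free cf'.
have az' : psi a z = s by rewrite psiN //; congruence.
have gz' : psi g z = t by rewrite psiN //; congruence.
rewrite ?as_ ?gt ?az' ?gz' in S G SG S' G' SG' F F'.
have {}T' : t = q \/ psi e t = t by case: S' => [/F'|]; [left | right].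
have {F}S0 : s = y \/ phi e s = s by case: S => [/F|]; [left | right].
case: S0 => [sy|es].
  have es' : psi e s = s by rewrite sy psie.
  have tq : t = q by case: T' => // /SG'.
  by apply: zst; split; [left | right].
(* Here [s] misses [e] before the swap and [o] after it, and [t] the other way round. So both lie on
   the swapped chain, which forces [s = q] and [t = y]. *)
have ot : phi o t = t by case: G => // /SG.
have tq : t <> q by congruence.
have et' : psi e t = t by case: T'.
have os' : psi o s = s by case: G' => // /(SG' et').
have os : phi o s <> s by move=> os; apply: eo; apply: (missing1 oph (v := s)).
have sK : s \in K by apply/negP => /negP sK; apply: os; rewrite -psi_out.
have sq : s = q by case/inK: sK => [|||[]] // E; congruence.
have ty : t = y.
  have tK : t \in K.
    apply/negP => /negP tK; apply: eo; apply: (missing1 oph (v := t)) => //.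
    by rewrite -psi_out.
  by case/inK: tK => [|||[]] // E; congruence.
by apply: zst; split; [right | left].
Qed.

(** Case analysis on the color missing at the [o]-neighbor [q] of [r]: [e] and [g] are excluded
    above, a swap of [g] and [b] turns [b] into [g], and a swap of [a] and [b] turns [a] into
    [b]. *)
Lemma no_config phi x y z a b e : config phi x y z a b e -> False.
Proof.
move=> cf; have [g [go ga gb ge gr]] := config_fourth cf.
have [oph mx oy ox zx ax bz ex] := cf.
have [oz ey my mxz mzx yx yz ao bo eo ab ea eb la lb le az ez] := configP cf.
have us : uniq [:: o; a; b; e; g] by distinct.
have [r er] : exists r, phi e z = r by exists (phi e z).
have cf4 := config4_of cf er us.
have [_ _ _ _ rz rx ry re or_ lg gz] := config4P cf4.
have no_b psi : config4 psi x y z r a b e g -> psi b (psi o r) = psi o r -> False.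
  move=> pf4; have [_ _ _ _ _ _ _ rpsi orpsi _ _] := config4P pf4.
  have [pf _ gpr _] := pf4; have [opsi mx' oy' ox' _ ax' bz' ex'] := pf.
  have [q orq] : exists q, psi o r = q by exists (psi o r).
  rewrite orq in orpsi *; have oq := optK opsi orq; move=> bq.
  have oz' := optK opsi ox'.
  have qz : q <> z by congruence.
  have [K [oK qK rK zK]] := push_from_r pf4 qz orpsi (or_intror bq).
  have cf' : config (kswap psi g b K) x y z a b e by split => //; kswap_solve.
  have er' : kswap psi g b K e z = r by case: pf4 => _ ? _ _; kswap_solve.
  apply: (no_common_g (config4_of cf' er' us)).
  by rewrite (@kswap_other _ _ _ _ o r) ?orq ?kswap_inL; congruence.
have [q orq] : exists q, phi o r = q by exists (phi o r).
have oq := optK oph orq; rewrite orq in or_.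
have [c cq] := missing q oph.
have := all_colors us erefl c; rewrite !inE.
move=> /or4P[/eqP E|/eqP E|/eqP E|/orP[/eqP E|/eqP E]]; rewrite E in cq.
- congruence.
- have qx : q <> x by congruence.
  have [K [oK qK xK zK]] := push_ugly oph ox zx mxz ax bz cq qx.
  have cf' : config (kswap phi a b K) x y z a b e by split => //; kswap_solve.
  have er' : kswap phi a b K e z = r by kswap_solve.
  apply: (no_b _ (config4_of cf' er' us)).
  by rewrite (@kswap_other _ _ _ _ o r) ?orq ?kswap_inR; congruence.
- by apply: (no_b _ cf4); congruence.
- by apply: (no_e_across_r cf4); congruence.
by apply: (no_common_g cf4); congruence.
Qed.

(** * Reaching the target class *)

(** A free vertex [y], its partner [mu y] and the [o]-neighbor of that partner would form a
    configuration. *)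
Lemma optimal_matches phi : optimal phi -> forall v, phi o v = mu v.
Proof.
move=> oph v; apply/eqP; apply/negP => /negP/eqP nv.
have [y oy] := exists_free oph nv.
have ox := no_free_pair oph oy.
have [c lc cx] := phi_mu oph.1 (mu y); rewrite muK in cx.
have [a ax] := missing (mu y) oph.
have [b bz] := missing (phi o (mu y)) oph.
by apply: (@no_config phi (mu y) y (phi o (mu y)) a b c); split; rewrite ?muK.
Qed.

Lemma exists_match phi : P phi -> exists2 psi, P psi & forall v, psi o v = mu v.
Proof.
have [n] := ubnP (total_weight phi); elim: n phi => // n IH phi le Pp.
have [[psi Ppsi lt]|h] : (exists2 psi, P psi & total_weight psi < total_weight phi) \/
    optimal phi; last by exists phi => //; apply: optimal_matches.
  have [//|nex] := classic
    (exists2 psi, P psi & total_weight psi < total_weight phi); first by left.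
  right; split=> // psi Ppsi; rewrite leqNgt; apply/negP => lt.
  by apply: nex; exists psi.
by apply: (IH psi) => //; lia.
Qed.

End MatchColorClass.

Lemma swap_colK k (a b : 'I_k) : involutive (swap_col a b).
Proof.
move=> c; have [->|/eqP ca] := eqVneq c a; first by rewrite swap_colL swap_colR.
have [->|/eqP cb] := eqVneq c b; first by rewrite swap_colR swap_colL.
by rewrite !swap_colN.
Qed.

(** * Edge colorings as families of involutions *)

Section EdgeColorings.

Variables (T : finType) (e : rel T).
Hypotheses (e_sym : symmetric e) (e_irr : irreflexive e) (e_reg : regular e 4).

Implicit Types (f : {ffun edge e -> 'I_5}) (g h : edge e) (u v w : T) (a b c d : 'I_5).

Lemma edge_at g v : v \in val g -> exists2 u, e v u & val g = [set v; u].
Proof.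
have /existsP[x /existsP[y /andP[exy /eqP E]]] := valP g.
rewrite E !inE => /orP[]/eqP->; [exists y | exists x] => //; last by rewrite setUC.
by rewrite e_sym.
Qed.

Lemma edge_of u v : e u v -> exists g, val g = [set u; v].
Proof.
move=> euv; have ie : is_edge e [set u; v].
  by apply/existsP; exists u; apply/existsP; exists v; rewrite euv eqxx.
by exists (Sub [set u; v] ie); rewrite SubK.
Qed.

Lemma edge_neq g u v : val g = [set v; u] -> u <> v.
Proof.
move=> E uv; have vg : v \in val g by rewrite E set21.
have [w ew] := edge_at vg.
rewrite E uv setUid => /setP/(_ w); rewrite !inE eqxx orbT => /eqP wv.
by rewrite wv e_irr in ew.
Qed.

Lemma edge_other g u w v : val g = [set v; u] -> val g = [set v; w] -> u = w.
Proof.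
move=> E E'; have uv := edge_neq E; have : u \in val g by rewrite E set22.
by rewrite E' !inE => /orP[/eqP|/eqP].
Qed.

Lemma proper_inj f g h v : proper_coloring f -> v \in val g -> v \in val h ->
  f g = f h -> g = h.
Proof.
move=> pf vg vh E; apply/eqP; apply/negPn/negP => gh.
have : adjacent_edges g h.
  by rewrite /adjacent_edges gh; apply/existsP; exists v; rewrite vg vh.
by move=> /pf; rewrite E eqxx.
Qed.

Definition nbr f c v :=
  odflt v [pick u | [exists g, (val g == [set v; u]) && (f g == c)]].

Lemma nbr_eq f g u v : proper_coloring f -> val g = [set v; u] -> nbr f (f g) v = u.
Proof.
move=> pf E; rewrite /nbr; case: pickP => [w /existsP[h /andP[/eqP Eh /eqP fh]]|none] /=.
  have gh : h = g by apply: (proper_inj (v := v) pf) => //; rewrite ?Eh ?E set21.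
  by apply: edge_other E; rewrite -gh.
by have /existsP[] := none u; exists g; rewrite E !eqxx.
Qed.

Lemma nbr_edge f c v : nbr f c v <> v ->
  exists2 g, val g = [set v; nbr f c v] & f g = c.
Proof.
rewrite /nbr; case: pickP => [u /existsP[g /andP[/eqP E /eqP fg]] _|] //=.
by exists g.
Qed.

Lemma nbr_at f g v : proper_coloring f -> v \in val g -> val g = [set v; nbr f (f g) v].
Proof. by move=> pf /edge_at[u _ E]; rewrite (nbr_eq pf E). Qed.

Lemma nbrK f c : proper_coloring f -> involutive (nbr f c).
Proof.
move=> pf v; have [E|/eqP/nbr_edge[g E fg]] := eqVneq (nbr f c v) v.
  by rewrite !E.
by rewrite setUC in E; rewrite -[RHS](nbr_eq pf E) fg.
Qed.

Lemma nbr_simple f c d v : proper_coloring f -> nbr f c v = nbr f d v ->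
  nbr f c v <> v -> c = d.
Proof.
move=> pf E nv; have nd : nbr f d v <> v by rewrite -E.
have [g Eg <-] := nbr_edge nv; have [h Eh <-] := nbr_edge nd.
by congr (f _); apply: val_inj; rewrite Eg Eh E.
Qed.

(** The colors present at [v] correspond to its four neighbors, which leaves one color out of
    five. *)
Lemma nbr_missing f v : proper_coloring f ->
  exists c, forall d, (nbr f d v == v) = (d == c).
Proof.
move=> pf; set A := [set c | nbr f c v != v].
have cA : #|A| = #|[set u | e v u]|.
  rewrite -(card_in_imset (f := fun c => nbr f c v) (D := A)); last first.
    by move=> c d; rewrite !inE => /eqP nc _ E; apply: nbr_simple E nc.
  apply: eq_card => u; rewrite !inE; apply/imsetP/idP => [[c]|evu].
    rewrite inE => /eqP/nbr_edge[g Eg _] ->.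
    have vg : v \in val g by rewrite Eg set21.
    have [w evw Ew] := edge_at vg.
    by rewrite (edge_other Eg Ew).
  have [g Eg] := edge_of evu; exists (f g); rewrite ?inE (nbr_eq pf Eg) //.
  by apply/eqP; apply: edge_neq Eg.
have : #|~: A| == 1 by rewrite -(eqn_add2l #|A|) cardsC card_ord cA e_reg.
move=> /cards1P[c /setP E]; exists c => d.
by have := E d; rewrite !inE negbK.
Qed.

(** * Swaps on closed sets as sequences of interchanges *)

Definition fswap f (a b : 'I_5) (K : {set T}) : {ffun edge e -> 'I_5} :=
  [ffun g : edge e => if val g \subset K then swap_col a b (f g) else f g].

Section Swap.

Variables (f : {ffun edge e -> 'I_5}) (a b : 'I_5) (K : {set T}).
Hypotheses (pf : proper_coloring f) (clK : kclosed (nbr f) a b K).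

(** An edge of color [a] or [b] meeting [K] lies inside [K], and [swap_col] fixes all other colors,
    so any one end of [g] decides. *)
Lemma fswapE g v : v \in val g ->
  fswap f a b K g = if v \in K then swap_col a b (f g) else f g.
Proof.
move=> vg; rewrite ffunE; case: ifP => [/subsetP/(_ v vg)-> //|/negP gK].
case: ifP => // vK; have [na nb] := clK vK.
have Eg := nbr_at pf vg.
by rewrite swap_colN // => E; apply: gK; rewrite Eg E subUset !sub1set vK ?na ?nb.
Qed.

Lemma fswap_proper : proper_coloring (fswap f a b K).
Proof.
move=> g h /andP[gh /existsP[v /andP[vg vh]]]; rewrite !(fswapE (v := v)) //.
apply: contra gh => /eqP E; apply/eqP; apply: (proper_inj pf vg vh).
by move: E; case: ifP => // _; apply: (can_inj (swap_colK a b)).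
Qed.

Lemma nbr_fswap c v : nbr (fswap f a b K) c v = kswap (nbr f) a b K c v.
Proof.
set c' := if v \in K then swap_col a b c else c.
have -> : kswap (nbr f) a b K c v = nbr f c' v by rewrite /kswap /c'; case: ifP.
have colE g : v \in val g -> (fswap f a b K g == c) = (f g == c').
  move=> vg; rewrite (fswapE vg) /c'; case: ifP => // _.
  by rewrite -(inj_eq (can_inj (swap_colK a b))) swap_colK.
have [E|/eqP/nbr_edge[g Eg fg]] := eqVneq (nbr f c' v) v.
  rewrite E; apply/eqP; apply/negPn/negP => /eqP/nbr_edge[g Eg /eqP fg].
  have vg : v \in val g by rewrite Eg set21.
  have fg' : f g = c' by apply/eqP; rewrite -colE.
  by apply: (edge_neq Eg); rewrite -{2}E -fg'; apply/esym/nbr_eq.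
have vg : v \in val g by rewrite Eg set21.
have <- : fswap f a b K g = c by apply/eqP; rewrite colE // fg.
exact: nbr_eq fswap_proper Eg.
Qed.

End Swap.

Lemma kempe_rel_nbr f a b u w : proper_coloring f -> kempe_rel f a b u w ->
  w = nbr f a u \/ w = nbr f b u.
Proof.
move=> pf /existsP[g /and4P[ug wg uw fg]]; have Eg := nbr_at pf ug.
have -> : w = nbr f (f g) u.
  by move: wg; rewrite Eg !inE => /orP[/eqP E|/eqP //]; rewrite E eqxx in uw.
by case/orP: fg => /eqP->; [left | right].
Qed.

Lemma kempe_component_closed f a b v : proper_coloring f ->
  kclosed (nbr f) a b [set u | connect (kempe_rel f a b) v u].
Proof.
move=> pf u; rewrite !inE => vu.
have step c : (c == a) || (c == b) -> connect (kempe_rel f a b) v (nbr f c u).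
  move=> cab; have [->//|/eqP nu] := eqVneq (nbr f c u) u.
  apply: connect_trans vu (connect1 _); have [g Eg fg] := nbr_edge nu.
  by apply/existsP; exists g; rewrite Eg set21 set22 fg cab eq_sym; case: eqP nu.
by split; apply: step; rewrite eqxx ?orbT.
Qed.

Lemma kempe_component_sub f a b (K : {set T}) v : proper_coloring f ->
  kclosed (nbr f) a b K -> v \in K ->
  [set u | connect (kempe_rel f a b) v u] \subset K.
Proof.
move=> pf cl vK; apply/subsetP => u; rewrite inE => /connectP[p + ->].
elim: p v vK => //= w p IH v vK /andP[vw wp]; apply: IH => //.
by have [na nb] := cl v vK; case: (kempe_rel_nbr pf vw) => ->.
Qed.

Lemma interchangeE f a b v :
  Defs.interchange f a b v = fswap f a b [set u | connect (kempe_rel f a b) v u].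
Proof.
apply/ffunP => g; rewrite !ffunE.
case: (_ \subset _); last by rewrite andbF.
rewrite andbT; case: ifP => // /norP[/eqP fa /eqP fb].
by rewrite swap_colN.
Qed.

(** Induction on the size of [K]: one interchange treats the component [C] of a vertex of [K], and
    [K :\: C] is still closed for the new coloring. *)
Lemma fswap_reachable f a b (K : {set T}) : proper_coloring f ->
  kclosed (nbr f) a b K -> kempe_reachable f (fswap f a b K).
Proof.
have [n] := ubnP #|K|; elim: n K f => // n IH K f le pf cl.
have [K0|[v vK]] := set_0Vmem K.
  have -> : fswap f a b K = f; last exact: rt_refl.
  apply/ffunP => g; rewrite ffunE K0 subset0; case: eqP => // g0.
  have /existsP[x /existsP[y /andP[_ /eqP E]]] := valP g.
  by have := set21 x y; rewrite -E g0 inE.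
have [C [Csub Ccl vC istep]] : exists C : {set T}, [/\ C \subset K,
    kclosed (nbr f) a b C, v \in C & Defs.interchange f a b v = fswap f a b C].
  exists [set u | connect (kempe_rel f a b) v u]; split.
  - exact: kempe_component_sub.
  - exact: kempe_component_closed.
  - by rewrite inE connect0.
  exact: interchangeE.
have pf1 := fswap_proper pf Ccl.
have cl1 : kclosed (nbr (fswap f a b C)) a b (K :\: C).
  move=> u; rewrite inE => /andP[uC uK]; have [na nb] := cl u uK.
  rewrite !nbr_fswap // !kswap_out // !inE na nb !andbT.
  by split; apply: contra uC => uC; have [] := Ccl _ uC; rewrite !nbrK.
have -> : fswap f a b K = fswap (fswap f a b C) a b (K :\: C).
  apply/ffunP => g.
  have /existsP[x /existsP[y /andP[_ /eqP E]]] := valP g.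
  have xg : x \in val g by rewrite E set21.
  rewrite (fswapE pf cl xg) (fswapE pf1 cl1 xg) (fswapE pf Ccl xg) inE.
  by have [/(subsetP Csub)->|] := boolP (x \in C).
apply: rt_trans (IH _ _ _ pf1 cl1).
  by apply: rt_step; exists a, b, v; rewrite istep.
apply: leq_trans (proper_card _) le; rewrite properEneq subsetDl andbT.
by apply/eqP => /setP/(_ v); rewrite !inE vC vK.
Qed.

(** * Settling the color classes one after the other *)

(** An instance of [exists_match]: the live colors are those from [k] on, [o] is [k], and [mu] comes
    from class [k] of [g]. *)
Lemma match_one_class (f g : {ffun edge e -> 'I_5}) (k : nat) :
  k < 4 -> proper_coloring f -> proper_coloring g ->
  (forall h, g h != ord_max) ->
  (forall c h, c < k -> (f h == c) = (g h == c)) ->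
  exists f', [/\ kempe_reachable f f', proper_coloring f' &
    forall c h, c < k.+1 -> (f' h == c) = (g h == c)].
Proof.
move=> k4 pf pg g4 fg; pose o : 'I_5 := Ordinal (leqW k4).
(* Each vertex misses exactly one color of [g], and that is [ord_max]; so every class below 4 is a
   perfect matching. *)
have gmiss c v : c < 4 -> nbr g c v <> v.
  move=> c4 E; have [d dP] := nbr_missing v pg.
  have /eqP cd : c == d by rewrite -dP E.
  have : nbr g ord_max v == v.
    apply/negPn/negP => /eqP/nbr_edge[h _ /eqP hm].
    by move: (g4 h); rewrite hm.
  by rewrite dP -cd => /eqP E'; rewrite -E' in c4.
(* Pointwise equality with [nbr f'] suffices, because [nbr_fswap] identifies a swapped family only
   pointwise. *)
pose P phi := exists f', [/\ kempe_reachable f f', proper_coloring f',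
  forall c h, c < k -> (f' h == c) = (g h == c) & forall c v, phi c v = nbr f' c v].
have Pf : P (nbr f) by exists f; split => //; exact: rt_refl.
have agree f' c v : proper_coloring f' ->
    (forall c h, c < k -> (f' h == c) = (g h == c)) -> c < k -> nbr f' c v = nbr g c v.
  move=> pf' fg' ck; have gv := @gmiss c v (ltn_trans ck k4).
  have [h Eh gh] := nbr_edge gv.
  have /eqP fh : f' h == c by rewrite fg' // gh.
  by rewrite -[in LHS]fh; apply: nbr_eq.
have [] := @exists_match T (fun c => k <= c) o (nbr g o) P _ _ _ _ _ _ _ _ _ _ Pf.
- by rewrite /=.
- exact: nbrK.
- by move=> v; apply: gmiss.
- by move=> phi [f' [_ pf' _ E]] c v; rewrite !E nbrK.
- by move=> phi [f' [_ pf' _ E]] c d v; rewrite !E; apply: nbr_simple.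
- move=> phi [f' [_ pf' fg' E]] v; have [c cP] := nbr_missing v pf'.
  have cv : nbr f' c v = v by apply/eqP; rewrite cP.
  exists c; last by rewrite E.
  rewrite leqNgt; apply/negP => ck; apply: (@gmiss c v); first exact: ltn_trans ck k4.
  by rewrite -(agree f').
- move=> phi [f' [_ pf' _ E]] c d v; rewrite !E; have [m mP] := nbr_missing v pf'.
  by move=> /eqP + /eqP; rewrite !mP => /eqP-> /eqP->.
- move=> phi [f' [_ pf' fg' E]] v.
  have [h Eh gh] := nbr_edge (@gmiss o v k4).
  exists (f' h); last by rewrite E; apply: nbr_eq.
  rewrite leqNgt; apply/negP => ck.
  have := fg' _ h ck; rewrite eqxx gh => /esym/eqP E'.
  by move: ck; rewrite -E' /= ltnn.
- move=> phi a b K [f' [rf' pf' fg' E]] ak bk cl.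
  have cl' : kclosed (nbr f') a b K by move=> v /cl; rewrite !E.
  exists (fswap f' a b K); split.
  + by apply: rt_trans rf' _; apply: fswap_reachable.
  + exact: fswap_proper.
  + move=> c h ck; rewrite -fg' // ffunE; case: ifP => // _.
    have nc d : k <= d -> c != d by apply: contraTneq => <-; rewrite -ltnNge.
    by rewrite -(inj_eq (can_inj (swap_colK a b))) swap_colK swap_colN //;
      apply/eqP; apply: nc.
  by move=> c v; rewrite nbr_fswap // /kswap; case: ifP.
move=> phi [f' [rf' pf' fg' E]] match_o; exists f'; split=> // c h.
rewrite ltnS leq_eqVlt => /orP[/eqP ck|]; last exact: fg'.
have -> : c = o by apply: val_inj.
have /existsP[x /existsP[y /andP[_ /eqP Eh]]] := valP h.
have xh : x \in val h by rewrite Eh set21.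
have same : nbr f' o x = nbr g o x by rewrite -E match_o.
apply/eqP/eqP => ho.
  have Efh := nbr_at pf' xh; rewrite ho same in Efh.
  have [h' Eh' <-] := nbr_edge (@gmiss o x k4).
  by congr (g _); apply: val_inj; rewrite Efh Eh'.
have Egh := nbr_at pg xh; rewrite ho -same in Egh.
have [h' Eh' <-] := nbr_edge (edge_neq Egh).
by congr (f' _); apply: val_inj; rewrite Egh Eh'.
Qed.

End EdgeColorings.

Theorem theorem4p1 (T : finType) (e : rel T) :
  simple_graph e -> regular e 4 -> chromatic_index_is e 4 ->
  forall f g : {ffun edge e -> 'I_5},
    proper_coloring f -> proper_coloring g ->
    (forall h : edge e, g h != ord_max) ->
    kempe_reachable f g.
Proof.
move=> [esym eirr] ereg _ f g pf pg g4.
have stage k : k <= 4 -> exists f', [/\ kempe_reachable f f', proper_coloring f' &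
    forall (c : 'I_5) h, c < k -> (f' h == c) = (g h == c)].
  elim: k => [_|k IH k4]; first by exists f; split=> //; exact: rt_refl.
  have [f1 [r1 p1 m1]] := IH (ltnW k4).
  have [f2 [r2 p2 m2]] := match_one_class esym eirr ereg k4 p1 pg g4 m1.
  by exists f2; split=> //; apply: rt_trans r1 r2.
have [f' [rf _ m]] := stage 4 isT.
have <- : f' = g; last by [].
(* As [g] avoids [ord_max], the color [g h] is below 4, where the two colorings have the same
   classes. *)
apply/ffunP => h; apply/eqP; rewrite m ?eqxx //.
have := ltn_ord (g h); rewrite ltnS leq_eqVlt => /orP[/eqP E|//].
by case/eqP: (g4 h); apply: val_inj.
Qed.
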